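(* Let $M=(V,A,E)$ be an acyclic mixed graph and let $s\in V$ be given. Then $M$ can be oriented (completed) as an acyclic digraph with an out-branching rooted at $s$ if and only if $M$ has no $s$-obstruction.
   Context: A mixed graph $M=(V,A,E)$ consists of a finite vertex set $V$, a set $A$ of arcs (directed) and a set $E$ of (undirected) edges. Its directed part is the digraph $(V,A)$, and $M$ is acyclic if $(V,A)$ has no directed cycle. A completion (orientation) of $M$ is a digraph $(V,A\cup A')$, where $A'$ is obtained from $E$ by orienting each edge $uv\in E$ in exactly one of its two directions. A digraph is acyclic if it has no directed cycle. An out-branching rooted at $s$ in a digraph $D$ is a spanning subdigraph of $D$ whose underlying graph is a spanning tree and in which every vertex is reachable from $s$ by a directed path; $D$ contains one if and only if every vertex of $D$ is reachable from $s$ by a directed path in $D$. A partition of $V$ into three pairwise disjoint sets $(Y,B,X)$ with $Y\cup B\cup X=V$, where $B\neq\emptyset$ ($Y$ and $X$ are allowed to be empty), is an $s$-obstruction if: (i) $s\in Y\cup X$; (ii) there are no edges of $E$ and no arcs of $A$ (in either direction) with one end in $Y$ and the other in $B$; (iii) every vertex in $X$ is reachable by a directed path of $(V,A)$ from some vertex in $B$. *)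

(* Defs.v *)
From mathcomp Require Import all_boot.
Set Implicit Arguments.
Unset Strict Implicit.
Unset Printing Implicit Defensive.

(* A digraph on V is a relation on V. *)

(* Lists of one vertex (loops) and of two vertices (opposite arcs) count as
   directed cycles. *)
Definition acyclic_digraph (V : finType) (D : rel V) : Prop :=
  forall c : seq V, c != [::] -> ~ ucycle D c.

Definition underlying (V : finType) (D : rel V) : rel V :=
  [rel u v | D u v || D v u].

(* Backtracking along an edge makes [:: u; v] a cycle of any symmetric
   relation, hence the bound on the size. *)
Definition forest (V : finType) (G : rel V) : Prop :=
  forall c : seq V, 2 < size c -> ~ ucycle G c.

Definition tree (V : finType) (G : rel V) : Prop :=
  [/\ symmetric G, irreflexive G, forall u v, connect G u v & forest G].

(* The second clause, together with irreflexivity in the third, says that the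
   relation [underlying T] really is the underlying graph of T: opposite arcs
   would contribute two parallel edges, which [underlying] merges. *)
Definition out_branching (V : finType) (D : rel V) (s : V) (T : rel V) : Prop :=
  [/\ subrel T D,
      forall u v, ~~ (T u v && T v u),
      tree (underlying T)
    & forall v, connect T s v].

(* An arc and an edge may join the same two vertices. *)
Record mixed_graph (V : finType) := MixedGraph {
  arc : rel V;
  edge : rel V;
  edge_sym : symmetric edge;
  edge_irr : irreflexive edge
}.

Definition acyclic_mixed (V : finType) (M : mixed_graph V) : Prop :=
  acyclic_digraph (arc M).

Definition edge_orientation (V : finType) (E A' : rel V) : Prop :=
  subrel A' E /\ forall u v, E u v -> A' u v (+) A' v u.

Definition completion (V : finType) (M : mixed_graph V) (D : rel V) : Prop :=
  exists2 A' : rel V, edge_orientation (edge M) A' & D =2 relU (arc M) A'.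

Definition tripartition (V : finType) (Y B X : {set V}) : Prop :=
  [/\ [disjoint Y & B], [disjoint Y & X], [disjoint B & X]
    & Y :|: B :|: X = [set: V]].

Definition obstruction (V : finType) (M : mixed_graph V) (s : V)
    (Y B X : {set V}) : Prop :=
  [/\ tripartition Y B X /\ B != set0,
      s \in Y :|: X,
      forall y b, y \in Y -> b \in B ->
        [/\ ~~ edge M y b, ~~ arc M y b & ~~ arc M b y]
    & forall x, x \in X -> exists2 b, b \in B & connect (arc M) b x].

(* Main.v *)
Require Import Defs.
From mathcomp Require Import all_boot.
Set Implicit Arguments.
Unset Strict Implicit.
Unset Printing Implicit Defensive.

Local Notation arc := Defs.arc.

(** Necessity.  Let D be an acyclic completion in which s reaches everything,
    and suppose that (Y, B, X) is an obstruction.  Choose b in B that no other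
    vertex of B reaches in D.  As s is outside B, the vertex b has a
    predecessor u in D.  This u is not in B by the choice of b, and not in Y
    since nothing joins Y to B; so u is in X, hence is reached from some vertex
    of B, which must be b.  Then b reaches u and u precedes b: a cycle.

    Sufficiency.  Without obstructions, s has no incoming arc.  Starting from s,
    list the vertices greedily: append a vertex as soon as all its arc
    predecessors are listed and some listed vertex is joined to it by an arc or
    an edge ([admissible]).  If this stops with a nonempty set R of unlisted
    vertices, let B be the set of sources of R.  By acyclicity B is nonempty and
    reaches all of R ([acyclic_minimal]); a listed vertex adjacent to a vertex
    of B would allow the latter to be appended, so the listed vertices, B and
    the rest of R form an obstruction ([admissible_extend]).  Hence all vertices
    get listed; orient every edge forwards along the list.  The result is
    acyclic, every vertex but s has an in-neighbour, and choosing one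
    in-neighbour for each gives the out-branching ([ranked_out_branching]). *)

Lemma acyclic_no_return (V : finType) (D : rel V) (u v : V) :
  acyclic_digraph D -> connect D u v -> ~~ D v u.
Proof.
move=> acyD /connectP[p Dp ->{v}]; apply/negP.
case/shortenP: Dp => q Dq Uq _ Dlast.
by apply: (acyD (u :: q)) => //; rewrite /ucycle /= rcons_path Dq Dlast.
Qed.

(** By acyclicity a proper ancestor has strictly fewer ancestors, so a member
    of [P] with the fewest ancestors will do. *)
Lemma acyclic_minimal (V : finType) (D : rel V) (P : pred V) (x : V) :
  acyclic_digraph D -> P x ->
  exists2 b, P b & forall u, P u -> connect D u b -> u = b.
Proof.
move=> acyD Px.
case: (arg_minnP (fun v => #|[pred w | connect D w v]|) Px) => b Pb min_b.
exists b => // u Pu Dub; apply/eqP/negPn/negP => neq_ub.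
have := min_b u Pu; rewrite leqNgt => /negP; apply; apply: proper_card.
apply/properP; split=> [|].
  by apply/subsetP => w; rewrite !inE => /connect_trans; apply.
exists b; rewrite !inE ?connect0 //; apply/negP => Dbu.
have /connectP[[|z p] /=] := Dub.
  by move=> _ eq_bu; rewrite eq_bu eqxx in neq_ub.
case/andP=> Duz Dp eq_b; have Dzb: connect D z b by apply/connectP; exists p.
by have := acyclic_no_return acyD (connect_trans Dzb Dbu); rewrite Duz.
Qed.

Lemma connect_last_step (V : finType) (D : rel V) (s v : V) :
  connect D s v -> v != s -> exists u, D u v.
Proof.
case/connectP=> p; case/lastP: p => [_ /= ->|p w]; first by rewrite eqxx.
rewrite rcons_path last_rcons => /andP[_ Dw] -> _.
by exists (last s p).
Qed.

Lemma obstruction_no_branching (V : finType) (M : mixed_graph V) (s : V)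
    (D : rel V) (Y B X : {set V}) :
  completion M D -> acyclic_digraph D -> (forall v, connect D s v) ->
  ~ obstruction M s Y B X.
Proof.
move=> [A' [A'E _] defD] acyD reach.
case=> [[[dYB _ dBX covV] /set0Pn[x Bx]] sYX noYB reachX].
have [b Bb min_b] := acyclic_minimal (P := mem B) acyD Bx.
have neq_bs: b != s.
  apply: contraTneq sYX => <-; rewrite inE negb_or.
  by rewrite (disjointFl dYB Bb) (disjointFr dBX Bb).
have [u Dub] := connect_last_step (reach b) neq_bs.
have sub_arc: subrel (arc M) D by move=> y z Ayz; rewrite defD /= Ayz.
have: u \in Y :|: B :|: X by rewrite covV inE.
rewrite !inE => /orP[/orP[Yu | Bu] | Xu].
- have [nE nA _] := noYB u b Yu Bb; move: Dub.
  by rewrite defD /= (negPf nA) /= => /A'E; rewrite (negPf nE).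
- have eq_ub := min_b u Bu (connect1 Dub).
  by have := acyclic_no_return acyD (connect0 D b); rewrite -{1}eq_ub Dub.
have [b' Bb' Ab'u] := reachX u Xu.
have Db'u: connect D b' u.
  by apply: connect_sub Ab'u => y z /sub_arc; apply: connect1.
have eq_b' := min_b b' Bb' (connect_trans Db'u (connect1 Dub)).
by have := acyclic_no_return acyD Db'u; rewrite eq_b' Dub.
Qed.

Lemma ranked_acyclic (V : finType) (D : rel V) (f : V -> nat) :
  (forall u v, D u v -> f u < f v) -> acyclic_digraph D.
Proof.
move=> ltD [|x c] // _ /andP[/= Dc _].
have lt_trans: transitive (relpre f ltn) by move=> v u w /=; apply: ltn_trans.
have /(order_path_min lt_trans)/allP/(_ x): path (relpre f ltn) x (rcons c x).
  by apply: sub_path Dc => u v /ltD.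
by rewrite mem_rcons mem_head /= ltnn => /(_ isT).
Qed.

Lemma underlying_sym (V : finType) (D : rel V) : symmetric (underlying D).
Proof. by move=> u v; apply: orbC. Qed.

(** In a cycle of length at least three, the two neighbours of a vertex of
    highest rank are distinct, yet both are its parent. *)
Lemma parent_forest (V : finType) (T : rel V) (f : V -> nat) :
  (forall u v, T u v -> f u < f v) ->
  (forall u u' v, T u v -> T u' v -> u = u') ->
  forest (underlying T).
Proof.
move=> ltT uniqT c c_gt2 /andP[Tc Uc].
have [x0 cx0]: exists x, x \in c.
  by case: c c_gt2 {Tc Uc} => // x c; exists x; rewrite mem_head.
case: (arg_maxnP f (P := mem c) cx0) => m cm max_m.
have parent w : w \in c -> underlying T w m -> T w m.
  move=> cw /= /orP[//|/ltT lt_mw].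
  by have := max_m w cw; rewrite /= leqNgt lt_mw.
have [i q def_c] := rot_to cm.
move: Tc Uc c_gt2 (parent); rewrite -(rot_cycle i) -(rot_uniq i).
rewrite -(size_rot i c).
have {}parent w : w \in m :: q -> underlying T w m -> T w m.
  by rewrite -def_c mem_rot; apply: parent.
rewrite def_c; case: q parent {def_c} => [|y q] // parent.
case/lastP: q parent => [|q z] // parent.
rewrite /= rcons_path last_rcons => /and3P[Tmy _ Tzm] Uc _ _.
have Tym: T y m.
  by apply: parent; [rewrite !inE eqxx orbT | rewrite underlying_sym].
have {}Tzm: T z m.
  by apply: parent => //; rewrite !inE mem_rcons mem_head !orbT.
move: Uc; rewrite (uniqT _ _ _ Tym Tzm) mem_rcons mem_head.
by rewrite /= andbF.
Qed.

(** Ranks decrease from child to parent, so following parents ends in [s]. *)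
Lemma ranked_out_branching (V : finType) (D : rel V) (s : V) (f : V -> nat) :
  (forall u v, D u v -> f u < f v) ->
  (forall v, v != s -> exists u, D u v) ->
  exists T, out_branching D s T.
Proof.
move=> ltD inD; pose par v := odflt s [pick u | D u v].
have Dpar v : v != s -> D (par v) v.
  rewrite /par => /inD[u Duv]; case: pickP => [w //|/(_ u)].
  by rewrite Duv.
pose T := [rel u v | (v != s) && (par v == u)].
have subT: subrel T D by move=> u v /andP[/Dpar Dv /eqP <-].
have ltT u v : T u v -> f u < f v by move/subT/ltD.
have reachT v : connect T s v.
  have [n] := ubnP (f v); elim: n v => // n IHn v /ltnSE le_v.
  have [-> | neq_vs] := eqVneq v s; first exact: connect0.
  have Tv: T (par v) v by rewrite /= neq_vs eqxx.
  have Tsp := IHn (par v) (leq_trans (ltT _ _ Tv) le_v).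
  exact: connect_trans Tsp (@connect1 _ T _ _ Tv).
have symT := underlying_sym T.
have reachU v : connect (underlying T) s v.
  by apply: connect_sub (reachT v) => x y Txy; apply/connect1/orP; left.
exists T; split=> // [u v|]; first last.
  split=> // [u|u v|].
  - by apply/negP => /orP[] /ltT; rewrite ltnn.
  - apply: connect_trans (reachU v).
    by rewrite (same_connect_r (sym_connect_sym symT) (reachU u)) connect0.
  by apply: (parent_forest ltT) => u u' v /andP[_ /eqP <-] /andP[_ /eqP <-].
by apply/negP => /andP[/ltT lt_uv /ltT]; rewrite ltnNge ltnW.
Qed.

(** As [index u l] is [size l] when [u] is not in [l], and [v] is in [l], the
    comparisons below also say that [u] is in [l]; so [l] is closed under
    arc predecessors. *)
Definition admissible (V : finType) (M : mixed_graph V) (s : V) (l : seq V) :=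
  [/\ uniq l, s \in l,
      forall u v, v \in l -> arc M u v -> index u l < index v l
    & forall v, v \in l -> v != s ->
        exists2 u, arc M u v || edge M u v & index u l < index v l].

Lemma admissible_rcons (V : finType) (M : mixed_graph V) (s : V) (l : seq V)
    (u0 v : V) :
  admissible M s l -> v \notin l -> (forall u, arc M u v -> u \in l) ->
  u0 \in l -> arc M u0 v || edge M u0 v -> admissible M s (rcons l v).
Proof.
case=> Ul ls lt_arc lt_in nlv lv lu0 adj.
have idx_old u : u \in l -> index u (rcons l v) = index u l.
  by move=> lu; rewrite -cats1 index_cat lu.
have idx_new : index v (rcons l v) = size l.
  by rewrite -cats1 index_cat (negPf nlv) /= eqxx addn0.
have old u w : w \in l -> index u l < index w l -> u \in l.
  by move=> lw lt_uw; rewrite -index_mem (ltn_trans lt_uw) // index_mem.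
split=> [||u w|w]; rewrite ?rcons_uniq ?nlv // ?mem_rcons !inE ?ls ?orbT //.
- case/predU1P=> [->|lw] Auw; first by rewrite idx_new idx_old ?index_mem lv.
  have lt_uw := lt_arc u w lw Auw.
  by rewrite !idx_old // (old u w).
case/predU1P=> [-> _|lw neq_ws].
  by exists u0 => //; rewrite idx_new idx_old // index_mem.
have [u adj_uw lt_uw] := lt_in w lw neq_ws.
by exists u => //; rewrite !idx_old // (old u w).
Qed.

(** If no vertex can be appended, then the listed vertices, the sources of the
    unlisted part and the remaining vertices form an obstruction.  No arc leads
    from a source back to a listed vertex, as [l] is closed under arc
    predecessors. *)
Lemma admissible_extend (V : finType) (M : mixed_graph V) (s : V) (l : seq V) :
  acyclic_mixed M -> ~ (exists Y B X, obstruction M s Y B X) ->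
  admissible M s l -> (exists x, x \notin l) ->
  exists v, admissible M s (rcons l v).
Proof.
move=> acyM noObs adm_l [x0 nlx0]; have [_ ls lt_arc _] := adm_l.
pose src v := (v \notin l) && [forall u, arc M u v ==> (u \in l)].
have [/existsP[v /andP[/andP[nlv /forallP lv] /existsP[u /andP[lu adj]]]]|] :=
  boolP [exists v, src v && [exists u, (u \in l) && (arc M u v || edge M u v)]].
  exists v; apply: admissible_rcons lu adj => // w.
  exact/implyP/lv.
move=> /existsPn stuck; case: noObs.
have above x : x \notin l -> exists2 b, src b & connect (arc M) b x.
  move=> nlx; pose P := [pred w | (w \notin l) && connect (arc M) w x].
  have [|b /andP[nlb Abx] min_b] := @acyclic_minimal _ _ P x acyM.
    by rewrite /= nlx connect0.
  exists b; rewrite // /src nlb; apply/forallP => u; apply/implyP => Aub.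
  apply: contraT => nlu.
  have eq_ub: u = b.
    apply: min_b (connect1 Aub).
    by rewrite /= nlu (connect_trans (connect1 Aub) Abx).
  by have := acyclic_no_return acyM (connect0 _ b); rewrite -{1}eq_ub Aub.
exists [set v in l], [set v | src v], [set v | (v \notin l) && ~~ src v].
split=> [||y b|x].
- split; last first.
    by have [b sb _] := above x0 nlx0; apply/set0Pn; exists b; rewrite inE.
  split.
  + by rewrite disjoints_subset; apply/subsetP => v; rewrite !inE /src => ->.
  + by rewrite disjoints_subset; apply/subsetP => v; rewrite !inE => ->.
  + by rewrite disjoints_subset; apply/subsetP => v; rewrite !inE andbC => ->.
  by apply/setP => v; rewrite !inE /src; case: (v \in l) => //=; apply: orbN.
- by rewrite !inE ls.
- rewrite !inE => ly sb; have := stuck b; rewrite sb /= => /existsPn/(_ y).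
  rewrite ly negb_or => /andP[nA nE]; split=> //.
  apply/negP => Aby; have := lt_arc b y ly Aby; have /andP[nlb _] := sb.
  by rewrite (memNindex nlb) ltnNge index_size.
rewrite inE => /andP[/above[b sb Abx] _].
by exists b; rewrite ?inE.
Qed.

Lemma admissible_total (V : finType) (M : mixed_graph V) (s : V) :
  acyclic_mixed M -> ~ (exists Y B X, obstruction M s Y B X) ->
  exists2 l, admissible M s l & forall v, v \in l.
Proof.
move=> acyM noObs.
have grow n l : #|V| - size l <= n -> admissible M s l ->
    exists2 l', admissible M s l' & forall v, v \in l'.
  elim: n l => [|n IHn] l le_n adm_l;
    have [/forallP l_all|] := boolP [forall v, v \in l]; try by exists l.
  - case/forallPn=> x nlx; case: adm_l => Ul _ _ _.
    have: size (x :: l) <= #|V| by rewrite -(card_uniqP _) ?max_card //= nlx.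
    by rewrite /= -subn_gt0 ltnNge le_n.
  case/forallPn=> x nlx.
  have [|v adm_v] := admissible_extend acyM noObs adm_l; first by exists x.
  by apply: IHn adm_v; rewrite size_rcons subnS; case: (_ - _) le_n.
apply: (grow _ [:: s] (leqnn _)).
split=> // [|u v|v]; rewrite ?inE ?eqxx //; last by move->.
(* An arc into s makes all vertices but s an obstructing B, with X = {s}. *)
move=> /eqP-> Aus; case: noObs; exists set0, [set~ s], [set s].
have neq_us: u != s.
  by apply: contraTneq Aus => ->; apply: acyclic_no_return (connect0 _ s).
split=> [||y b|x].
- split; last by apply/set0Pn; exists u; rewrite !inE.
  split; try by rewrite disjoints_subset ?sub0set.
  by rewrite set0U setUC setUCr.
- by rewrite !inE eqxx.
- by rewrite inE.
by rewrite inE => /eqP->; exists u; rewrite ?inE ?connect1.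
Qed.

Theorem theorem2p3 (V : finType) (M : mixed_graph V) (s : V)
    (acyM : acyclic_mixed M) :
  (exists D : rel V, [/\ completion M D, acyclic_digraph D
     & exists T : rel V, out_branching D s T])
  <-> ~ (exists Y B X : {set V}, obstruction M s Y B X).
Proof.
split=> [[D [cD acyD [T [subT _ _ reachT]]]] [Y [B [X obs]]]|noObs].
  apply: (obstruction_no_branching cD acyD) obs => v.
  by apply: connect_sub (reachT v) => x y /subT; apply: connect1.
have [l [_ _ lt_arc lt_in] l_all] := admissible_total acyM noObs.
pose A' := [rel u v | edge M u v && (index u l < index v l)].
have ltD u v : relU (arc M) A' u v -> index u l < index v l.
  by case/orP=> [|/andP[]//]; apply: lt_arc.
exists (relU (arc M) A'); split.
- exists A' => //; split=> [u v /andP[]//|u v Euv].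
  have neq_uv: index u l != index v l.
    apply: contraTneq Euv => eq_idx.
    have ->: u = v by apply: (index_inj u) eq_idx.
    by rewrite edge_irr.
  by rewrite /= [edge M v u]edge_sym Euv /=; case: ltngtP neq_uv.
- exact: ranked_acyclic ltD.
apply: (ranked_out_branching ltD) => v neq_vs.
have [u adj lt_uv] := lt_in v (l_all v) neq_vs.
by exists u; rewrite /= lt_uv andbT.
Qed.
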